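(* Let $R$ be a ring, $M$ a right $R$-module, $S=\mathrm{End}_R(M)$ and $f\in S$. (1) If $Sf^n$ is a projective left $S$-module for some positive integer $n$, then the submodule $N=\bigcap\{\mathrm{Ker}\, g\mid g\in S,\ \mathrm{Im} f^n\leq \mathrm{Ker}\, g\}$ is a direct summand of $M$. (2) If $M$ is a self-cogenerator and $S$ is a generalized left principally projective ring, then $M$ is a dual $\pi$-Rickart module.
   Context: Rings are associative with identity and modules are unitary right modules. $M$ is dual $\pi$-Rickart if for every $f\in S$ there exist $e^2=e\in S$ and a positive integer $n$ such that $\mathrm{Im} f^n=eM$. $M$ is a self-cogenerator if it cogenerates all its factor modules, i.e. every factor module of $M$ embeds in a direct product of copies of $M$. A ring $T$ is generalized left principally projective if for every $x\in T$ there is a positive integer $n$ such that the left annihilator $\{t\in T: tx^n=0\}$ of $x^n$ is generated, as a left ideal, by an idempotent of $T$. *)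

(* Defs.v *)
From HB Require Import structures.
From mathcomp Require Import all_boot all_algebra.
From mathcomp Require Import all_classical.

Set Implicit Arguments.
Unset Strict Implicit.
Unset Printing Implicit Defensive.

Import GRing.Theory.
Local Open Scope classical_set_scope.
Local Open Scope ring_scope.

(* An [lmodType] is a left module: a right R-module is an [lmodType R^c].
   Rings are [pzRingType]s (associative, unital, possibly zero): End_R(M) is
   the zero ring when M = 0. *)

Section Endomorphisms.
Variables (K : pzRingType) (M : lmodType K).

Definition endo : Type := {linear M -> M}.

HB.instance Definition _ := gen_eqMixin endo.
HB.instance Definition _ := gen_choiceMixin endo.

Implicit Types f g h : endo.

Lemma endoP f g : f =1 g -> f = g.
Proof.
case: f g => f [[fA] [fZ]] [g [[gA] [gZ]]] /= /funext fg; case: _ / fg in gA gZ *.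
by rewrite (Prop_irrelevance gA fA) (Prop_irrelevance gZ fZ).
Qed.

Definition endo0 : endo := \0 : {linear M -> M}.
Definition endo_opp f : endo := \- f : {linear M -> M}.
Definition endo_add f g : endo := f \+ g : {linear M -> M}.
Definition endo1 : endo := idfun : {linear M -> M}.
(* endomorphisms act on the left: (f g)(x) = f (g x) *)
Definition endo_mul f g : endo := f \o g : {linear M -> M}.

Fact endo_addA : associative endo_add.
Proof. by move=> f g h; apply: endoP => x /=; rewrite addrA. Qed.
Fact endo_addC : commutative endo_add.
Proof. by move=> f g; apply: endoP => x /=; rewrite addrC. Qed.
Fact endo_add0 : left_id endo0 endo_add.
Proof. by move=> f; apply: endoP => x /=; rewrite add0r. Qed.
Fact endo_addN : left_inverse endo0 endo_opp endo_add.
Proof. by move=> f; apply: endoP => x /=; rewrite addNr. Qed.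

HB.instance Definition _ :=
  GRing.isZmodule.Build endo endo_addA endo_addC endo_add0 endo_addN.

Fact endo_mulA : associative endo_mul.
Proof. by move=> f g h; apply: endoP. Qed.
Fact endo_mul1l : left_id endo1 endo_mul.
Proof. by move=> f; apply: endoP. Qed.
Fact endo_mul1r : right_id endo1 endo_mul.
Proof. by move=> f; apply: endoP. Qed.
Fact endo_mulDl : left_distributive endo_mul endo_add.
Proof. by move=> f g h; apply: endoP. Qed.
Fact endo_mulDr : right_distributive endo_mul endo_add.
Proof. by move=> f g h; apply: endoP => x /=; rewrite linearD. Qed.

HB.instance Definition _ := GRing.Zmodule_isPzRing.Build endo
  endo_mulA endo_mul1l endo_mul1r endo_mulDl endo_mulDr.

Definition Im (f : endo) : set M := range f.
Definition Ker (f : endo) : set M := [set x | f x = 0].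

End Endomorphisms.

Section Submodules.
Variables (K : pzRingType) (M : lmodType K).

Definition is_submodule (N : set M) : Prop := GRing.submod_closed [in N].

Record submodule : Type := Submodule {
  carrier :> set M;
  submoduleP : is_submodule carrier
}.

Definition in_submodule (N : submodule) : {pred M} := fun x => x \in carrier N.

HB.instance Definition _ (N : submodule) :=
  GRing.isSubmodClosed.Build K M (in_submodule N)
    (GRing.submod_closed_semi (submoduleP N)).

(* N as a K-module in its own right *)
Definition submod_type (N : submodule) : Type := {x : M | in_submodule N x}.
HB.instance Definition _ (N : submodule) := SubChoice.on (submod_type N).
HB.instance Definition _ (N : submodule) :=
  [SubChoice_isSubLmodule of submod_type N by <:].

(* M = N (+) L, as an internal direct sum *)
Definition direct_summand (N : set M) : Prop :=
  is_submodule N /\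
  exists L : submodule,
    N `&` L = [set 0] /\ (forall x, exists y z, [/\ N y, carrier L z & x = y + z]).

End Submodules.

Section FactorModule.
Variables (K : pzRingType) (M : lmodType K) (N : submodule M).

Definition factor_module : Type := Quotient.quot (in_submodule N).
HB.instance Definition _ := EqQuotient.on factor_module.
HB.instance Definition _ := GRing.Zmodule.on factor_module.

Local Open Scope quotient_scope.

Definition factor_proj (x : M) : factor_module := \pi x.
Definition factor_scale (a : K) (u : factor_module) : factor_module :=
  factor_proj (a *: repr u).

Fact factor_projD : {morph factor_proj : x y / x + y}.
Proof. by move=> x y; rewrite /factor_proj piE. Qed.

Fact factor_projZ a x : factor_scale a (factor_proj x) = factor_proj (a *: x).
Proof.
apply/eqP; rewrite -Quotient.idealrBE -scalerBr; apply: rpredZ.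
by rewrite Quotient.idealrBE; apply/eqP; exact: reprK.
Qed.

Fact factor_projK u : factor_proj (repr u) = u.
Proof. exact: reprK. Qed.

Fact factor_scaleA a b u :
  factor_scale a (factor_scale b u) = factor_scale (a * b) u.
Proof. by rewrite -[u]factor_projK !factor_projZ scalerA. Qed.
Fact factor_scale1 : left_id 1 factor_scale.
Proof. by move=> u; rewrite -[u]factor_projK factor_projZ scale1r. Qed.
Fact factor_scaleDr : right_distributive factor_scale +%R.
Proof.
move=> a u v; rewrite -[u]factor_projK -[v]factor_projK.
by rewrite -factor_projD !factor_projZ -factor_projD scalerDr.
Qed.
Fact factor_scaleDl u : {morph factor_scale^~ u : a b / a + b}.
Proof.
move=> a b; rewrite -[u]factor_projK !factor_projZ.
by rewrite -factor_projD scalerDl.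
Qed.

HB.instance Definition _ := GRing.Zmodule_isLmodule.Build K factor_module
  factor_scaleA factor_scale1 factor_scaleDr factor_scaleDl.

End FactorModule.

Section Modules.
Variables (K : pzRingType) (M : lmodType K).

Definition projective : Prop :=
  forall (A B : lmodType K) (p : {linear A -> B}) (h : {linear M -> B}),
    (forall b, exists a, p a = b) ->
    exists k : {linear M -> A}, forall x, p (k x) = h x.

(* [I -> M] carries the pointwise module structure: it is the product M^I *)
Definition self_cogenerator : Prop :=
  forall N : submodule M,
    exists (I : Type) (phi : {linear factor_module N -> (I -> M)}),
      injective phi.

Definition dual_pi_Rickart : Prop :=
  forall f : endo M, exists (e : endo M) (n : nat),
    [/\ e * e = e, (0 < n)%N & Im (f ^+ n) = Im e].

End Modules.

Section Rings.
Variable T : pzRingType.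

Definition left_annihilator (x : T) : set T := [set t | t * x = 0].

Definition principal_left_ideal (x : T) : set T := [set t * x | t in [set: T]].

Fact principal_left_ideal_submodule (x : T) :
  is_submodule (principal_left_ideal x : set T^o).
Proof.
split=> [|a u v]; rewrite !inE; first by exists 0; rewrite ?mul0r.
move=> [s _ <-] [t _ <-]; exists (a * s + t) => //.
by rewrite mulrDl -mulrA.
Qed.

(* T x as a submodule of the regular left module T *)
Definition left_ideal (x : T) : submodule T^o :=
  Submodule (principal_left_ideal_submodule x).

Definition generalized_left_pp : Prop :=
  forall x : T, exists (n : nat) (e : T),
    [/\ (0 < n)%N, e * e = e &
        left_annihilator (x ^+ n) = principal_left_ideal e].

End Rings.

(* Main.v *)
Require Import Defs.
From HB Require Import structures.
From mathcomp Require Import all_boot all_algebra all_classical.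
Import GRing.Theory.
Local Open Scope classical_set_scope.
Local Open Scope ring_scope.

(** Write [N x] for the intersection of the kernels of all [g] with
    [Im x <= Ker g], i.e. [g * x = 0]; it depends only on the left annihilator
    of [x].  If [x] has the same left annihilator as an idempotent [e], then
    [N x = Im e], because [1 - e] is one of the [g].  If [S x] is projective,
    a section [k] of [S -> S x] provides the idempotent [e = k x]; if the left
    annihilator of [x] is [S d] with [d] idempotent, take [e = 1 - d].  Over a
    self-cogenerator, the coordinates of an embedding of [M / Im x] into a power
    of [M] show that [N x = Im x]. *)

Definition image_closure {K : pzRingType} {M : lmodType K} (x : endo M) : set M :=
  \bigcap_(g in [set g : endo M | Im x `<=` Ker g]) Ker g.

Lemma Im_sub_KerP {K : pzRingType} {M : lmodType K} (g x : endo M) :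
  Im x `<=` Ker g <-> g * x = 0.
Proof.
split=> [sub | gx _ [m _ <-]]; last exact: (congr1 (fun h : endo M => h m) gx).
by apply: endoP => m; apply: sub; exists m.
Qed.

Lemma Im_submodule {K : pzRingType} {M : lmodType K} (x : endo M) :
  is_submodule (Im x).
Proof.
split=> [|a _ _ /set_mem [m _ <-] /set_mem [m' _ <-]]; apply: mem_set.
  by exists 0; rewrite ?linear0.
by exists (a *: m + m'); rewrite ?linearP.
Qed.

Lemma direct_summand_Im_idempotent {K : pzRingType} {M : lmodType K} (e : endo M) :
  e * e = e -> direct_summand (Im e).
Proof.
move=> ee; have eK m : e (e m) = e m by exact: (congr1 (fun h : endo M => h m) ee).
split; first exact: Im_submodule.
exists (Submodule (Im_submodule (1 - e))); split.
  (* If [e m = (1 - e) m'], applying [e] to both sides gives [e m = 0]. *)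
  apply/seteqP; split=> [y [[m _ <-] [m' _ /= eq_m]] | y ->] /=.
    by rewrite -eK -eq_m linearB /= eK subrr.
  by split; exists 0; rewrite ?linear0.
move=> m; exists (e m), ((1 - e : endo M) m).
by split; [exists m | exists m | rewrite /= addrC subrK].
Qed.

Lemma image_closure_idempotent {K : pzRingType} {M : lmodType K} (x e : endo M) :
  e * e = e -> (forall g, g * x = 0 <-> g * e = 0) -> image_closure x = Im e.
Proof.
move=> ee annE; apply/seteqP; split=> [m Nm | _ [m _ <-] g /Im_sub_KerP /annE ge].
  have/Nm : Im x `<=` Ker (1 - e).
    by apply/Im_sub_KerP/annE; rewrite mulrBl mul1r ee subrr.
  by move=> /eqP; rewrite /= subr_eq0 => /eqP mE; exists m.
exact: (congr1 (fun h : endo M => h m) ge).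
Qed.

Lemma factor_proj_eq0 {K : pzRingType} {M : lmodType K} (N : submodule M) (y : M) :
  factor_proj N y = 0 <-> carrier N y.
Proof.
(* Writing zero as a class turns the goal into an equality of two classes, which [idealrBE] decides
   by their difference. *)
have -> : (0 : factor_module N) = factor_proj N 0.
  by apply: (addrI (factor_proj N 0)); rewrite -factor_projD !addr0.
split=> [/eqP|Ny]; first by rewrite -Quotient.idealrBE subr0 => /set_mem.
by apply/eqP; rewrite -Quotient.idealrBE subr0; apply: mem_set.
Qed.

Lemma self_cogenerator_image_closure {K : pzRingType} {M : lmodType K} (x : endo M) :
  self_cogenerator M -> image_closure x = Im x.
Proof.
move=> /(_ (Submodule (Im_submodule x))) [I [phi phi_inj]].
apply/seteqP; split=> [y Ny | y Imy g]; last exact.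
apply/(factor_proj_eq0 (Submodule (Im_submodule x))).
apply: phi_inj; rewrite linear0; apply: funext => i.
(* The [i]-th coordinate of [phi] after the projection is an endomorphism of [M] that kills [Im x],
   so [Ny] forces it to kill [y]. *)
pose g m := phi (factor_proj (Submodule (Im_submodule x)) m) i.
have g_lin : linear g.
  by move=> a u v; rewrite /g factor_projD -factor_projZ linearP.
pose ge : endo M := HB.pack g (GRing.isLinear.Build _ _ _ _ g g_lin).
apply: (Ny ge) => z Imz.
have /factor_proj_eq0 z0 : carrier (Submodule (Im_submodule x)) z by [].
by rewrite /Ker /= /g z0 linear0.
Qed.

Lemma projective_left_ideal_idempotent (T : pzRingType) (x : T) :
    projective (submod_type (left_ideal x)) ->
  exists e : T, e * e = e /\ forall t, t * x = 0 <-> t * e = 0.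
Proof.
have mulx_in t : in_submodule (left_ideal x) (t * x) by apply: mem_set; exists t.
(* Right multiplication by [x] maps [T] onto [T x]; projectivity lifts the identity of [T x] to a
   section [k]. *)
pose p (t : T^o) : submod_type (left_ideal x) := Sub (t * x) (mulx_in t).
have p_lin : linear p by move=> a t u; apply: val_inj; rewrite /= mulrDl -mulrA.
pose pl : {linear T^o -> submod_type (left_ideal x)} :=
  HB.pack p (GRing.isLinear.Build _ _ _ _ p p_lin).
have p_surj b : exists a, pl a = b.
  have [t _ tx] := set_mem (valP b).
  by exists t; apply: val_inj.
move=> /(_ _ _ pl idfun p_surj) [k kK].
pose e : T := k (p 1).
have kE t : k (p t) = t * e.
  by rewrite -[RHS]/(t *: k (p 1)) -linearZ; congr (k _); apply: val_inj; rewrite /= mul1r.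
(* Since [p 1] is [x] itself, the section identity at [p 1] reads [e * x = x]. *)
have ex : e * x = x.
  by have /(congr1 val) := kK (p 1); rewrite /= mul1r.
have annE t u : t * x = u * x -> t * e = u * e.
  by move=> tu; rewrite -!kE; congr (k _); apply: val_inj.
(* Idempotence is [annE] applied to [e * x = 1 * x]. *)
exists e; split; first by rewrite -[RHS]mul1r; apply: annE; rewrite ex mul1r.
move=> t; split=> [tx0 | te0]; last by rewrite -ex mulrA te0 mul0r.
by rewrite -(mul0r e); apply: annE; rewrite mul0r.
Qed.

(** As [d] is idempotent, [t] lies in [T d] exactly when [t = t * d], that is, when [1 - d] is
    killed by [t] on the left. *)
Lemma left_annihilator_idempotent (T : pzRingType) (x d : T) :
    d * d = d -> left_annihilator x = principal_left_ideal d ->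
  (1 - d) * (1 - d) = 1 - d /\ forall t, t * x = 0 <-> t * (1 - d) = 0.
Proof.
move=> dd annE; have d0 : d * (1 - d) = 0 by rewrite mulrBr mulr1 dd subrr.
split=> [|t]; first by rewrite mulrBl mul1r d0 subr0.
have -> : (t * x = 0) = principal_left_ideal d t by rewrite -annE.
split=> [[s _ <-] | /eqP]; first by rewrite -mulrA d0 mulr0.
by rewrite mulrBr mulr1 subr_eq0 => /eqP tE; exists t.
Qed.

Theorem theorem3p4 (R : pzRingType) (M : lmodType R^c) (f : endo M) :
  (forall n : nat, (0 < n)%N ->
     projective (submod_type (left_ideal (f ^+ n))) ->
     direct_summand
       (\bigcap_(g in [set g : endo M | Im (f ^+ n) `<=` Ker g]) Ker g))
  /\
  (self_cogenerator M -> generalized_left_pp (endo M) -> dual_pi_Rickart M).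
Proof.
split=> [n _ /projective_left_ideal_idempotent [e [ee annE]] | cogM ppS h].
  rewrite -/(image_closure (f ^+ n)) (image_closure_idempotent _ _ ee annE).
  exact: direct_summand_Im_idempotent.
have [n [d [n_gt0 dd annE]]] := ppS h.
have [ee eann] := left_annihilator_idempotent _ _ _ dd annE.
exists (1 - d), n; split=> //.
(* Both [Im (h ^+ n)] and [Im (1 - d)] equal the image closure of [h ^+ n]. *)
by rewrite -(self_cogenerator_image_closure _ cogM) (image_closure_idempotent _ _ ee eann).
Qed.
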